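(* Let $G$ be a simple connected graph and let $m>3$ be an even integer. Then $G$ has property (SR) if and only if $F_1^m(G)$ has property (-SR).
   Context: A graph is nonsingular if its adjacency matrix is nonsingular. A nonsingular graph $G$ has property (SR) if for each eigenvalue $\lambda$ of $A(G)$, $1/\lambda$ is also an eigenvalue of $A(G)$, with the same multiplicity as $\lambda$. A nonsingular graph $G$ has property (-SR) if for each eigenvalue $\lambda$ of $A(G)$, $-1/\lambda$ is also an eigenvalue of $A(G)$, with the same multiplicity as $\lambda$. The $m$-shadow graph $D_m(G)$ consists of $m$ copies $G_1,\dots,G_m$ of $G$, where each vertex $u$ in $G_i$ is joined to the neighbors of the corresponding vertex in $G_j$, $1\le i,j\le m$; its adjacency matrix is $J_m\otimes A(G)$ with $J_m$ the $m\times m$ all-ones matrix. $F_1^m(G)$ ($m>3$) is obtained from $D_m(G)$ by deleting all edges connecting vertices of $G_i$ with vertices of $G_{m-(i-1)}$ for $2\le i\le m-1$ (if $i=m-(i-1)$ these are the edges inside $G_i$) and removing the edges of $G_1$. Thus its adjacency matrix is $B\otimes A(G)$, where $B$ is the $m\times m$ 0-1 matrix with zeros exactly at positions $(1,1)$ and $(i,m+1-i)$, $2\le i\le m-1$. *)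

(* Defs.v *)
From mathcomp Require Import all_boot all_order all_algebra.
Set Implicit Arguments. Unset Strict Implicit. Unset Printing Implicit Defensive.
Import GRing.Theory.
Local Open Scope ring_scope.

Record sgraph := SGraph {
  vertex :> finType;
  edge : rel vertex;
  edge_sym : symmetric edge;
  edge_irrefl : irreflexive edge }.

Definition connected_graph (G : sgraph) : Prop :=
  (0 < #|G|)%N /\ forall x y : G, connect (@edge G) x y.

(* Rows and columns are indexed through the enumeration of the vertices; a
   different enumeration would only conjugate by a permutation matrix. *)
Definition adjacency (R : nzRingType) (G : sgraph) : 'M[R]_#|G| :=
  \matrix_(i, j) (edge (enum_val i) (enum_val j))%:R.

Definition multiplicity (F : fieldType) (n : nat) (A : 'M[F]_n) (a : F) : nat :=
  mup a (char_poly A).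

Definition nonsingular (F : fieldType) (G : sgraph) : Prop :=
  adjacency F G \in unitmx.

Definition property_SR (F : fieldType) (G : sgraph) : Prop :=
  nonsingular F G /\
  forall a : F, eigenvalue (adjacency F G) a ->
    eigenvalue (adjacency F G) a^-1 /\
    multiplicity (adjacency F G) a^-1 = multiplicity (adjacency F G) a.

Definition property_mSR (F : fieldType) (G : sgraph) : Prop :=
  nonsingular F G /\
  forall a : F, eigenvalue (adjacency F G) a ->
    eigenvalue (adjacency F G) (- a^-1) /\
    multiplicity (adjacency F G) (- a^-1) = multiplicity (adjacency F G) a.

Section Shadow.
Variables (m : nat) (G : sgraph).

(* The vertex (i, u) is the copy of u in G_(i+1): copies are numbered from 0. *)
Definition shadow_edge : rel ('I_m * G) := fun x y => edge x.2 y.2.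

Lemma shadow_sym : symmetric shadow_edge.
Proof. by move=> x y; apply: edge_sym. Qed.

Lemma shadow_irrefl : irreflexive shadow_edge.
Proof. by move=> x; apply: edge_irrefl. Qed.

Definition shadow : sgraph := SGraph shadow_sym shadow_irrefl.

(* Pairs (i, j) of copies between which all edges of the shadow graph are
   deleted. In 0-based numbering the partner m - (i - 1) of i is rev_ord i, and
   2 <= i <= m - 1 becomes 0 < i < m.-1. *)
Definition F1_deleted : rel 'I_m := fun i j =>
  (i == 0 :> nat)%N && (j == 0 :> nat)%N || (0 < i < m.-1)%N && (j == rev_ord i).

Lemma F1_deleted_sym : symmetric F1_deleted.
Proof.
have imp i j : F1_deleted i j -> F1_deleted j i.
  case/orP=> [/andP[i0 j0]|/andP[/andP[i_gt0 i_lt] /eqP ->]].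
    by rewrite /F1_deleted i0 j0.
  apply/orP; right; rewrite rev_ordK eqxx andbT /= subn_gt0.
  by rewrite -ltn_predRL i_lt -subn1 ltn_sub2l // -subn_gt0 subn1
             (leq_ltn_trans _ i_lt).
by move=> i j; apply/idP/idP; apply: imp.
Qed.

Definition F1_edge : rel ('I_m * G) := fun x y =>
  @edge shadow x y && ~~ F1_deleted x.1 y.1.

Lemma F1_sym : symmetric F1_edge.
Proof. by move=> x y; rewrite /F1_edge edge_sym F1_deleted_sym. Qed.

Lemma F1_irrefl : irreflexive F1_edge.
Proof. by move=> x; rewrite /F1_edge edge_irrefl. Qed.

Definition F1 : sgraph := SGraph F1_sym F1_irrefl.

End Shadow.

(* Main.v *)
Require Import Defs.
From mathcomp Require Import all_boot all_order all_algebra.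
From mathcomp Require Import zify ring.

Set Implicit Arguments. Unset Strict Implicit. Unset Printing Implicit Defensive.
Import Order.TTheory GRing.Theory Num.Theory.
Local Open Scope ring_scope.

(** The adjacency matrix of F1 is a Kronecker product B (x) A, where A is the
    adjacency matrix of G and B is the symmetric 0-1 matrix [pattern] of the
    pairs of copies that stay joined. Both factors are diagonalizable, so the
    multiplicity of x for F1 is the sum, over the eigenvalues b of B counted
    with multiplicity, of mu (x / b), where mu is the multiplicity for G
    ([multiplicity_F1]).

    B has an explicit eigenbasis. Write i' for the partner m - 1 - i of i and
    t for the positive root of x ^ 2 = (m - 1) x + 1. An interior pair {i, i'}
    gives e_i - e_i' for the eigenvalue 1 and e_i + e_i' - 2 e_0 for -1; the
    vectors (1, ..., 1, x - m + 2), x being t or its conjugate -1/t, have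
    eigenvalue x. Numbering these eigenvalues b_i suitably gives
    b_i' = - 1 / b_i, hence the multiplicity of -1/x for F1 is the sum of the
    mu (b_i / x) ([multiplicity_F1_oppinv]). If mu is invariant under
    inversion, both sums agree term by term: this is one implication.

    Conversely, if F1 has property (-SR), then f y = mu (1/y) - mu y satisfies
    sum_i f (x / b_i) = 0 for every x. As t is strictly dominant among the b_i
    and f has finite support, f vanishes: for y of largest modulus in the
    support, evaluating at x = y t leaves the single term f y, since all the
    other arguments have larger modulus than y ([dilation_sum_eq0]). *)

(** * Multiplicities and reciprocity *)

Definition eigenbasis (F : fieldType) n (A V : 'M[F]_n) (d : 'rV[F]_n) : Prop :=
  V \in unitmx /\ V *m A = diag_mx d *m V.

Lemma char_poly_neq0 (F : fieldType) n (A : 'M[F]_n) : char_poly A != 0.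
Proof. exact/monic_neq0/char_poly_monic. Qed.

(** The identity V (x - A) = (x - diag d) V can be compared on determinants
    because det V is a nonzero constant polynomial. *)
Lemma char_poly_eigenbasis (F : fieldType) n (A V : 'M[F]_n) d :
  eigenbasis A V d -> char_poly A = \prod_i ('X - (d 0 i)%:P).
Proof.
case=> Vu VA.
have -> : char_poly A = char_poly (diag_mx d).
  have detV : \det (map_mx polyC V) != 0.
    by rewrite det_map_mx polyC_eq0 -unitfE -unitmxE.
  apply: (mulfI detV); rewrite /char_poly -det_mulmx mulrC -det_mulmx.
  congr (\det _); rewrite /char_poly_mx mulmxBr mulmxBl -!map_mxM VA.
  by rewrite scalar_mxC.
rewrite char_poly_trig ?diag_mx_is_trig //.
by apply: eq_bigr => i _; rewrite mxE eqxx mulr1n.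
Qed.

Lemma multiplicity_eigenbasis (F : fieldType) n (A V : 'M[F]_n) d a :
  eigenbasis A V d -> multiplicity A a = (\sum_i (d 0%R i == a))%N.
Proof.
move=> /char_poly_eigenbasis charA; rewrite /multiplicity charA.
rewrite -(big_map (fun i => d 0 i) xpredT (fun x => 'X - x%:P)) mu_prod_XsubC.
by rewrite -sum1_count big_map big_mkcond.
Qed.

Lemma eigenvalue_multiplicity (F : fieldType) n (A : 'M[F]_n) a :
  eigenvalue A a = (0 < multiplicity A a)%N.
Proof.
by rewrite eigenvalue_root_char -dvdp_XsubCl XsubC_dvd ?char_poly_neq0.
Qed.

Lemma unitmx_multiplicity0 (F : fieldType) n (A : 'M[F]_n) :
  (A \in unitmx) = (multiplicity A 0 == 0)%N.
Proof.
rewrite -[RHS]negbK -lt0n -eigenvalue_multiplicity /eigenvalue /eigenspace.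
by rewrite raddf0 subr0 negbK kermx_eq0 row_free_unit.
Qed.

(** An involution g that maps eigenvalues to eigenvalues also maps the other
    points to non-eigenvalues, so multiplicities agree there too, being 0. This
    frees (SR) and (-SR) from their restriction to eigenvalues; as 0^-1 = 0,
    the point 0 needs no exception either. *)
Lemma multiplicity_involution (F : fieldType) n (A : 'M[F]_n) (g : F -> F) :
  involutive g ->
  (forall a, eigenvalue A a ->
     eigenvalue A (g a) /\ multiplicity A (g a) = multiplicity A a)
  <-> forall a, multiplicity A (g a) = multiplicity A a.
Proof.
move=> gK; split=> [gA a | gA a Aa]; last first.
  by rewrite eigenvalue_multiplicity gA -eigenvalue_multiplicity.
have [/gA[]// | Aa] := boolP (eigenvalue A a).
have [/gA[] | Aga] := boolP (eigenvalue A (g a)).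
  by rewrite gK (negPf Aa).
move: Aa Aga; rewrite !eigenvalue_multiplicity !lt0n !negbK.
by move=> /eqP-> /eqP->.
Qed.

Lemma property_SRE (F : fieldType) (G : sgraph) :
  property_SR F G <-> multiplicity (adjacency F G) 0 = 0%N /\
    forall a, multiplicity (adjacency F G) a^-1 = multiplicity (adjacency F G) a.
Proof.
rewrite /property_SR /nonsingular unitmx_multiplicity0.
rewrite (multiplicity_involution _ (@invrK F)).
by split=> [[/eqP] | [/eqP]].
Qed.

Lemma property_mSRE (F : fieldType) (G : sgraph) :
  property_mSR F G <-> multiplicity (adjacency F G) 0 = 0%N /\
    forall a, multiplicity (adjacency F G) (- a^-1) =
              multiplicity (adjacency F G) a.
Proof.
rewrite /property_mSR /nonsingular unitmx_multiplicity0.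
have oppinvK : involutive (fun a : F => - a^-1) by move=> a; rewrite invrN invrK opprK.
rewrite (multiplicity_involution _ oppinvK).
by split=> [[/eqP] | [/eqP]].
Qed.

(** An adjacency matrix is real symmetric, so the spectral theorem applies. *)
Lemma adjacency_eigenbasis (C : numClosedFieldType) (G : sgraph) :
  exists V d, eigenbasis (adjacency C G) V d.
Proof.
set A := adjacency C G.
have /orthomx_spectralP A_eq : A \is normalmx.
  apply: symmetric_normalmx.
    by apply/is_hermitianmxP; apply/matrixP => i j; rewrite !mxE mul1r edge_sym.
  by apply/mxOverP => i j; rewrite mxE realn.
exists (spectralmx A), (spectral_diag A); split; first exact: spectral_unit.
by rewrite {2}A_eq !mulmxA mulmxV ?spectral_unit // mul1mx.
Qed.

(** * Kronecker products *)

Section Kronecker.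
Variables (m : nat) (T : finType).

(** The Kronecker product of X and Y, indexed by the enumeration of pairs so
    that adjacency matrices of graphs on 'I_m * T have this form on the nose. *)
Definition kron (R : pzSemiRingType) (X : 'M[R]_m) (Y : 'M[R]_#|T|) :
    'M[R]_#|{: 'I_m * T}| :=
  \matrix_(p, q) (X (enum_val p).1 (enum_val q).1 *
    Y (enum_rank (enum_val p).2) (enum_rank (enum_val q).2)).

Lemma sum_enum_pair (M : nmodType) (f : 'I_m -> 'I_#|T| -> M) :
  \sum_(p : 'I_#|{: 'I_m * T}|) f (enum_val p).1 (enum_rank (enum_val p).2) =
  \sum_i \sum_j f i j.
Proof.
rewrite -(big_enum_val (fun x : 'I_m * T => f x.1 (enum_rank x.2))) /=.
rewrite -(pair_bigA _ (fun i u => f i (enum_rank u))) /=.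
apply: eq_bigr => i _; rewrite (reindex_onto enum_rank enum_val) /=.
  by apply: eq_bigl => u; rewrite enum_rankK eqxx.
by move=> j _; rewrite enum_valK.
Qed.

Lemma kronM (R : comPzRingType) (X X' : 'M[R]_m) Y Y' :
  kron X Y *m kron X' Y' = kron (X *m X') (Y *m Y').
Proof.
apply/matrixP => p q; rewrite !mxE mulr_suml.
pose f i j := X (enum_val p).1 i * Y (enum_rank (enum_val p).2) j *
  (X' i (enum_val q).1 * Y' j (enum_rank (enum_val q).2)).
under eq_bigr do rewrite !mxE.
rewrite (sum_enum_pair f); apply: eq_bigr => i _; rewrite mulr_sumr.
by apply: eq_bigr => j _; rewrite /f; ring.
Qed.

Lemma kron1 (R : pzSemiRingType) : kron (1%:M : 'M[R]_m) 1%:M = 1%:M.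
Proof.
apply/matrixP => p q; rewrite !mxE -natrM mulnb (inj_eq enum_rank_inj).
by rewrite -(inj_eq enum_val_inj); case: (enum_val p) (enum_val q) => i u [].
Qed.

Variables (F : fieldType) (B S : 'M[F]_m) (b : 'rV[F]_m).
Variables (A V : 'M[F]_#|T|) (a : 'rV[F]_#|T|).
Hypotheses (Sb : eigenbasis B S b) (Va : eigenbasis A V a).

Lemma kron_eigenbasis :
  eigenbasis (kron B A) (kron S V)
    (\row_p (b 0 (enum_val p).1 * a 0 (enum_rank (enum_val p).2))).
Proof.
case: Sb Va => [Su SB] [Vu VA]; split.
  have: kron S V *m kron (invmx S) (invmx V) = 1%:M.
    by rewrite kronM !mulmxV ?kron1.
  by case/mulmx1_unit.
rewrite kronM SB VA !mul_diag_mx; apply/matrixP => p q; rewrite !mxE; ring.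
Qed.

Lemma multiplicity_kron x : (forall i, b 0 i != 0) ->
  multiplicity (kron B A) x = (\sum_i multiplicity A (x / b 0%R i))%N.
Proof.
move=> b_neq0; rewrite (multiplicity_eigenbasis _ kron_eigenbasis).
under eq_bigr do rewrite mxE.
rewrite (sum_enum_pair (fun i j => nat_of_bool (b 0 i * a 0 j == x))).
apply: eq_bigr => i _; rewrite (multiplicity_eigenbasis _ Va).
apply: eq_bigr => j _; congr (nat_of_bool _).
by apply/eqP/eqP => [<- | ->]; rewrite mulrC ?mulKf ?divfK.
Qed.

End Kronecker.

(** * The spectrum of the deletion pattern *)

Section Pattern.
Variables (C : numClosedFieldType) (m : nat).
Hypotheses (m_gt3 : (3 < m)%N) (m_even : ~~ odd m).

Definition pattern : 'M[C]_m := \matrix_(i, j) (~~ F1_deleted i j)%:R.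

Lemma adjacency_F1 (G : sgraph) :
  adjacency C (F1 m G) = kron pattern (adjacency C G).
Proof.
apply/matrixP => p q; rewrite !mxE !enum_rankK /= /F1_edge /=.
by rewrite -natrM mulnb andbC.
Qed.

(** The vectors that are constant on all copies but the last form a plane
    stable under the pattern matrix, whose characteristic polynomial there is
    x ^ 2 - (m - 1) x - 1; this is its positive root, the other is -1 / t. *)
Definition pattern_root : C := (m.-1%:R + sqrtC (m.-1%:R ^+ 2 + 4%:R)) / 2%:R.
Local Notation n := (m.-1%:R : C).
Local Notation t := pattern_root.

Lemma pattern_rootE : t ^+ 2 = n * t + 1.
Proof.
have := sqrtCK (n ^+ 2 + 4%:R); rewrite /t; set s := sqrtC _ => s2.
have -> : ((n + s) / 2%:R) ^+ 2 = (n ^+ 2 + 2%:R * n * s + s ^+ 2) / 4%:R by field.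
by rewrite s2; field.
Qed.

Lemma pattern_root_gt1 : 1 < t.
Proof.
rewrite /t ltr_pdivlMr ?ltr0n // mul1r ltr_wpDr //.
  by rewrite sqrtC_ge0 addr_ge0 ?exprn_ge0 ?ler0n.
by rewrite ltr_nat; case: m m_gt3.
Qed.

Lemma pattern_root_neq0 : t != 0.
Proof. by rewrite gt_eqF // (lt_trans ltr01 pattern_root_gt1). Qed.

Lemma pattern_rootV : t^-1 = t - n.
Proof.
apply: (mulfI pattern_root_neq0).
by rewrite divff ?pattern_root_neq0 // mulrBr -expr2 pattern_rootE; ring.
Qed.

Definition first_copy : 'I_m := Ordinal (ltn_trans (isT : 0 < 3)%N m_gt3).
Local Notation last_copy := (rev_ord first_copy).

Lemma interior_ord (i : 'I_m) :
  (0 < i < m.-1)%N = (i != first_copy) && (i != last_copy).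
Proof. by rewrite -!val_eqE /= subn1; have := ltn_ord i; lia. Qed.

Lemma rev_ord_half (i : 'I_m) : (rev_ord i < m./2)%N = ~~ (i < m./2)%N.
Proof. by rewrite /=; have := ltn_ord i; lia. Qed.

Lemma pattern_first j : pattern first_copy j = 1 - (j == first_copy)%:R.
Proof.
by rewrite mxE /F1_deleted /= orbF -val_eqE; case: (_ == _); rewrite ?subrr ?subr0.
Qed.

Lemma pattern_last j : pattern last_copy j = 1.
Proof.
rewrite mxE /F1_deleted interior_ord eqxx andbF orbF.
by rewrite (_ : _ && _ = false) //= subn1; lia.
Qed.

Lemma pattern_interior i j : i != first_copy -> i != last_copy ->
  pattern i j = 1 - (j == rev_ord i)%:R.
Proof.
move=> i0 i1; rewrite mxE /F1_deleted interior_ord i0 i1 /=.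
move: i0; rewrite -val_eqE /= => /negPf->.
by case: (j == rev_ord i); rewrite ?subrr ?subr0.
Qed.

Lemma pattern_sym i j : pattern i j = pattern j i.
Proof. by rewrite !mxE F1_deleted_sym. Qed.

Lemma sum_delta (a : 'I_m) (f : 'I_m -> C) : \sum_j (j == a)%:R * f j = f a.
Proof.
rewrite (bigD1 a) //= eqxx mul1r big1 ?addr0 // => j /negPf->.
by rewrite mul0r.
Qed.

Lemma pattern_row_sum i : \sum_j pattern i j = n + (i == last_copy)%:R.
Proof.
have sum1 : \sum_(j < m) 1 = n + 1 :> C.
  by rewrite sumr_const card_ord natr1 prednK // (ltn_trans _ m_gt3).
have sum1B a : \sum_(j < m) (1 - (j == a)%:R) = n :> C.
  rewrite sumrB sum1; under [X in _ - X]eq_bigr do rewrite -[_%:R]mulr1.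
  by rewrite sum_delta addrK.
have [-> | i1] := eqVneq i last_copy.
  by under eq_bigr do rewrite pattern_last.
rewrite addr0; have [-> | i0] := eqVneq i first_copy.
  by under eq_bigr do rewrite pattern_first.
by under eq_bigr do rewrite pattern_interior //.
Qed.

(** The indexing is chosen so that partner copies carry eigenvalues that are
    opposite inverses; as m is even, [i < m./2] selects one member of each
    interior pair. *)
Definition pattern_eigenvalue : 'rV[C]_m := \row_i
  if i == first_copy then t else if i == last_copy then n - t
  else if (i < m./2)%N then 1 else -1.
Local Notation ev i := (pattern_eigenvalue 0 i).

Definition pattern_basis : 'M[C]_m := \matrix_(i, j)
  if (i == first_copy) || (i == last_copy) then 1 + (ev i - n) * (j == last_copy)%:R
  else if (i < m./2)%N then (j == i)%:R - (j == rev_ord i)%:R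
  else (j == i)%:R + (j == rev_ord i)%:R - 2%:R * (j == first_copy)%:R.

Lemma last_neq_first : last_copy != first_copy.
Proof. by rewrite -val_eqE /=; lia. Qed.

Lemma ev_first : ev first_copy = t.
Proof. by rewrite mxE eqxx. Qed.

Lemma ev_last : ev last_copy = n - t.
Proof. by rewrite mxE (negPf last_neq_first) eqxx. Qed.

Lemma ev_interior i : i != first_copy -> i != last_copy ->
  ev i = if (i < m./2)%N then 1 else -1.
Proof. by move=> /negPf i0 /negPf i1; rewrite mxE i0 i1. Qed.

Lemma rev_ord_interior (i : 'I_m) : i != first_copy -> i != last_copy ->
  rev_ord i != first_copy /\ rev_ord i != last_copy.
Proof.
move=> i0 i1; split; last by rewrite (inj_eq rev_ord_inj).
by apply: contra i1 => /eqP <-; rewrite rev_ordK.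
Qed.

Lemma pattern_eigenvalue_rev i : ev (rev_ord i) = - (ev i)^-1.
Proof.
have [-> | i0] := eqVneq i first_copy.
  by rewrite ev_last ev_first pattern_rootV opprB.
have [-> | i1] := eqVneq i last_copy.
  by rewrite rev_ordK ev_first ev_last -opprB -pattern_rootV invrN invrK opprK.
have [r0 r1] := rev_ord_interior i0 i1.
by rewrite !ev_interior // rev_ord_half; case: (i < m./2)%N;
  rewrite /= ?invrN invr1 ?opprK.
Qed.

Lemma pattern_eigenvalue_neq0 i : ev i != 0.
Proof.
have [-> | i0] := eqVneq i first_copy; first by rewrite ev_first pattern_root_neq0.
have [-> | i1] := eqVneq i last_copy.
  by rewrite ev_last -opprB -pattern_rootV oppr_eq0 invr_eq0 pattern_root_neq0.
by rewrite ev_interior //; case: ifP; rewrite ?oppr_eq0 oner_neq0.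
Qed.

Lemma pattern_eigenvalue_dominant i : i != first_copy -> `|ev i| < `|ev first_copy|.
Proof.
have t_gt1 := pattern_root_gt1; have t_gt0 := lt_trans ltr01 t_gt1.
rewrite ev_first (gtr0_norm t_gt0) => i0.
have [-> | i1] := eqVneq i last_copy; last first.
  by rewrite ev_interior //; case: ifP; rewrite ?normrN normr1.
rewrite ev_last -opprB -pattern_rootV normrN gtr0_norm ?invr_gt0 //.
by apply: (lt_trans _ t_gt1); rewrite invf_lt1.
Qed.

(** This equation alone makes row i of [pattern_basis] an eigenvector for an
    end copy i, which treats the two roots at once. *)
Lemma end_eigenvalueE i : (i == first_copy) || (i == last_copy) ->
  ev i ^+ 2 = n * ev i + 1.
Proof.
case/orP=> /eqP->; rewrite ?ev_first ?ev_last ?pattern_rootE //.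
by rewrite sqrrB pattern_rootE; ring.
Qed.

Lemma pattern_basisE :
  pattern_basis *m pattern = diag_mx pattern_eigenvalue *m pattern_basis.
Proof.
rewrite mul_diag_mx; apply/matrixP => i l.
rewrite [LHS]mxE [RHS]mxE [X in _ = _ * X]mxE.
under eq_bigr do rewrite [X in X * _]mxE.
case: ifPn => [i_end | /norP[i0 i1]].
  under eq_bigr do rewrite mulrDl mul1r -mulrA.
  rewrite big_split -mulr_sumr /= sum_delta pattern_last.
  under eq_bigr do rewrite pattern_sym.
  rewrite pattern_row_sum; have := end_eigenvalueE i_end.
  by set x := ev i => x2; rewrite mulrDr mulrA mulrBr -expr2 x2; ring.
have [r0 r1] := rev_ord_interior i0 i1.
rewrite ev_interior //; case: ifP => _.
  under eq_bigr do rewrite mulrBl.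
  by rewrite sumrB !sum_delta !pattern_interior // rev_ordK; ring.
under eq_bigr do rewrite mulrBl mulrDl -mulrA.
rewrite sumrB big_split -mulr_sumr /= !sum_delta pattern_first.
rewrite (pattern_interior l i0 i1) (pattern_interior l r0 r1).
by rewrite rev_ordK; ring.
Qed.

(** A vector v orthogonal to all the rows is constant on the copies but the
    last, by the interior rows. The two rows of the ends then differ by a
    nonzero multiple of the last coordinate, which kills it, and then v. *)
Lemma pattern_basis_unit : pattern_basis \in unitmx.
Proof.
rewrite -unitmx_tr -row_free_unit -kermx_eq0; apply/eqP/row_matrixP => k.
have : row k (kermx pattern_basis^T) *m pattern_basis^T = 0.
  by rewrite -row_mul mulmx_ker row0.
rewrite row0; move: (row k _) => v vS.
have vSE i : \sum_j pattern_basis i j * v 0 j = 0.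
  have /rowP/(_ i) := vS; rewrite [LHS]mxE [RHS]mxE => vSi; rewrite -[RHS]vSi.
  by apply: eq_bigr => j _; rewrite mulrC [X in _ = _ * X]mxE.
have v_interior i : i != first_copy -> i != last_copy -> v 0 i = v 0 first_copy.
  have row_lo j : j != first_copy -> j != last_copy -> (j < m./2)%N ->
      v 0 j = v 0 (rev_ord j).
    move=> /negPf j0 /negPf j1 jlo; have := vSE j.
    under eq_bigr do rewrite [X in X * _]mxE j0 j1 jlo /= mulrBl.
    by rewrite sumrB !sum_delta => /eqP; rewrite subr_eq0 => /eqP.
  have row_hi j : j != first_copy -> j != last_copy -> ~~ (j < m./2)%N ->
      v 0 j + v 0 (rev_ord j) = 2%:R * v 0 first_copy.
    move=> /negPf j0 /negPf j1 /negPf jhi; have := vSE j.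
    under eq_bigr do rewrite [X in X * _]mxE j0 j1 jhi /= mulrBl mulrDl -mulrA.
    rewrite sumrB big_split -mulr_sumr /= !sum_delta => /eqP.
    by rewrite subr_eq0 => /eqP.
  move=> i0 i1; have [r0 r1] := rev_ord_interior i0 i1.
  have two_neq0 : 2%:R != 0 :> C by rewrite pnatr_eq0.
  apply: (mulfI two_neq0); have [ilo | ihi] := boolP (i < m./2)%N.
    rewrite -(row_hi (rev_ord i)) // ?rev_ord_half ?ilo // rev_ordK.
    by rewrite -(row_lo i) // mulr_natl.
  rewrite -(row_hi i) // (row_lo (rev_ord i)) ?rev_ord_half //.
  by rewrite rev_ordK mulr_natl.
have v_sum : \sum_j v 0 j = n * v 0 first_copy + v 0 last_copy.
  rewrite (bigD1 last_copy) //= addrC; congr (_ + _).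
  under eq_bigr => j j1.
    have -> : v 0 j = v 0 first_copy.
      by have [-> // | j0] := eqVneq j first_copy; apply: v_interior.
    over.
  by rewrite sumr_const cardC1 card_ord mulr_natl.
have row_end i : (i == first_copy) || (i == last_copy) ->
    n * v 0 first_copy + (1 + ev i - n) * v 0 last_copy = 0.
  move=> i_end; have := vSE i.
  under eq_bigr do rewrite [X in X * _]mxE i_end mulrDl mul1r -mulrA.
  by rewrite big_split -mulr_sumr /= sum_delta v_sum => <-; ring.
have e1 := row_end first_copy; have e2 := row_end last_copy.
rewrite eqxx /= ev_first in e1; rewrite eqxx orbT ev_last in e2.
have v_last : v 0 last_copy = 0.
  (* The difference of the two roots is t + t^-1. *)
  have tn : t - (n - t) != 0.
    rewrite opprB addrC addrAC -addrA -pattern_rootV.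
    by rewrite gt_eqF // addr_gt0 ?invr_gt0 // (lt_trans ltr01 pattern_root_gt1).
  apply: (mulfI tn); rewrite mulr0 -[RHS](subrr 0) -{1}e1 // -e2 //; ring.
have v_first : v 0 first_copy = 0.
  have n_neq0 : n != 0 by rewrite pnatr_eq0; lia.
  by apply: (mulfI n_neq0); rewrite mulr0 -e1 // v_last; ring.
apply/rowP => i; rewrite mxE.
have [-> // | i1] := eqVneq i last_copy; have [-> // | i0] := eqVneq i first_copy.
by rewrite v_interior.
Qed.

Lemma pattern_eigenbasis : eigenbasis pattern pattern_basis pattern_eigenvalue.
Proof. by split; [exact: pattern_basis_unit | exact: pattern_basisE]. Qed.

Lemma multiplicity_F1 (G : sgraph) x :
  multiplicity (adjacency C (F1 m G)) x =
  (\sum_i multiplicity (adjacency C G) (x / ev i))%N.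
Proof.
have [V [a Va]] := adjacency_eigenbasis C G.
rewrite adjacency_F1.
exact: (multiplicity_kron pattern_eigenbasis Va x pattern_eigenvalue_neq0).
Qed.

(** Exchanging partner copies turns each 1 / b into - b. *)
Lemma multiplicity_F1_oppinv (G : sgraph) x :
  multiplicity (adjacency C (F1 m G)) (- x^-1) =
  (\sum_i multiplicity (adjacency C G) (x / ev i)^-1)%N.
Proof.
rewrite multiplicity_F1 (reindex_inj rev_ord_inj) /=.
apply: eq_bigr => i _; rewrite pattern_eigenvalue_rev.
by rewrite invrN invrK mulrNN invf_div mulrC.
Qed.

End Pattern.

(** * Inverting a sum of dilations *)

(** At y of maximal modulus in the support of f, evaluate the sum at y * d i0:
    the terms i != i0 take f at points of larger modulus than y. *)
Lemma dilation_sum_eq0 (C : numClosedFieldType) (I : finType) (i0 : I)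
    (d : I -> C) (s : seq C) (f : C -> int) :
  (forall i, d i != 0) -> (forall i, i != i0 -> `|d i| < `|d i0|) ->
  f 0 = 0 -> (forall x, f x != 0 -> x \in s) ->
  (forall x, \sum_i f (x / d i) = 0) -> forall x, f x = 0.
Proof.
move=> d_neq0 dom f0 f_supp sumf x; apply/eqP; apply: contraT => fx.
have lt_x : (index x s < size s)%N by rewrite index_mem f_supp.
have Px : [pred j : 'I_(size s) | f s`_j != 0] (Ordinal lt_x).
  by rewrite /= nth_index ?f_supp.
have [|/= j fj max_j] := real_arg_maxP (F := fun j : 'I_(size s) => `|s`_j|) Px.
  by move=> j _; exact: normr_real.
have sj_neq0 : s`_j != 0 by apply: contraNneq fj => ->; rewrite f0.
case/eqP: fj; have := sumf (s`_j * d i0); rewrite (bigD1 i0) //= mulfK //.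
rewrite big1 ?addr0 // => i /dom lt_d; apply/eqP; apply: contraT => fy.
have lt_y : (index (s`_j * d i0 / d i) s < size s)%N by rewrite index_mem f_supp.
have := max_j (Ordinal lt_y); rewrite /= nth_index ?f_supp // => /(_ fy).
rewrite normrM normfV normrM ler_pdivrMr ?normr_gt0 //.
by rewrite ler_pM2l ?normr_gt0 // => /(lt_le_trans lt_d); rewrite ltxx.
Qed.

Theorem theorem5p3 (C : numClosedFieldType) (G : sgraph) (m : nat)
  (G_connected : connected_graph G) (m_gt3 : (3 < m)%N) (m_even : ~~ odd m) :
  property_SR C G <-> property_mSR C (F1 m G).
Proof.
rewrite property_SRE property_mSRE; set mu := multiplicity (adjacency C G).
set ev := fun i => pattern_eigenvalue C m_gt3 0 i.
have F1E x := multiplicity_F1 m_gt3 m_even G (x : C).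
have F1VE x := multiplicity_F1_oppinv m_gt3 m_even G (x : C).
split=> [[mu0 muV] | [F0 FV]].
  split=> [|x]; first by rewrite F1E big1 // => i _; rewrite mul0r.
  by rewrite F1VE F1E; apply: eq_bigr => i _; exact: muV.
have mu0 : mu 0 = 0%N.
  move: F0; rewrite F1E; under eq_bigr do rewrite mul0r.
  move=> /eqP; rewrite sum_nat_const card_ord muln_eq0 => /orP[/eqP m0|/eqP//].
  by move: (m_gt3); rewrite m0.
split=> // x; pose f y := (mu y^-1)%:Z - (mu y)%:Z.
have [V [a Va]] := adjacency_eigenbasis C G.
pose s := [seq a 0 j | j <- enum 'I_#|G|].
have mu_s y : mu y != 0%N -> y \in s.
  rewrite /mu (multiplicity_eigenbasis _ Va) sum_nat_eq0 negb_forall.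
  case/existsP=> j; rewrite eqb0 negbK => /eqP <-.
  by apply: map_f; rewrite mem_enum.
(* f can be nonzero only at eigenvalues of G and at their inverses. *)
suff /eqP : f x = 0 by rewrite subr_eq0 => /eqP[].
apply: (@dilation_sum_eq0 C _ (first_copy m_gt3) ev (s ++ map GRing.inv s)).
- exact: pattern_eigenvalue_neq0.
- exact: pattern_eigenvalue_dominant.
- by rewrite /f invr0 subrr.
- move=> y fy; rewrite mem_cat; have [//|/negPf nys] := boolP (y \in s).
  have mu_y : mu y = 0%N by apply/eqP; apply: contraFT nys; exact: mu_s.
  apply/mapP; exists y^-1; rewrite ?invrK //; apply: mu_s.
  by apply: contraNneq fy; rewrite /f mu_y => ->.
move=> y; rewrite sumrB; apply/eqP; rewrite subr_eq0; apply/eqP.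
by rewrite -!(big_morph _ PoszD (erefl _)) -F1VE -F1E FV.
Qed.
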